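(* Let $T$ be a set and let $\theta:\mathcal{F}(T)\to[0,\infty)$ be the ECF of a simple max-stable process on $T$. Then $\theta$ uniquely determines a positive Radon measure $\mu$ on $\mathcal{P}(T)\setminus\{\varnothing\}$ (that is, there is exactly one such measure) such that for all $A\in\mathcal{F}(T)$ $$\theta(A)=\mu\bigl(\{Q\in\mathcal{P}(T)\setminus\{\varnothing\}:A\cap Q\neq\varnothing\}\bigr)=\int_{\mathcal{P}(T)\setminus\{\varnothing\}}\mathbf{1}_{A\cap Q\neq\varnothing}\,\mu(\mathrm{d}Q),$$ where $\theta(\{t\})=1$ for $t\in T$. The function $\theta$ is bounded if and only if $\mu(\mathcal{P}(T)\setminus\{\varnothing\})<\infty$.
   Context: $\mathcal{F}(T)$ is the set of finite subsets of $T$. $\mathcal{P}(T)$ is the power set of $T$ with the topology generated by the maps $Q\mapsto\mathbf{1}_{t\in Q}$, $t\in T$ (i.e. $\{0,1\}^T$ with the product topology), and $\mathcal{P}(T)\setminus\{\varnothing\}$ carries the subspace topology. A Radon measure is a measure on the Borel $\sigma$-algebra that is finite on compact sets and inner regular (with respect to compact sets). Simple max-stable process: a process $X=\{X_t\}_{t\in T}$ with $\mathbb{P}(X_t\le x)=e^{-1/x}$ for all $t\in T$, $x>0$, such that for every $n\in\mathbb{N}$ and independent copies $X^{(1)},\dots,X^{(n)}$ of $X$ the process $\{\bigvee_{i=1}^nX^{(i)}_t\}_{t\in T}$ has the same law (finite-dimensional distributions) as $\{nX_t\}_{t\in T}$. Extremal coefficient function (ECF) of a simple max-stable process $X$: $\theta:\mathcal{F}(T)\to[0,\infty)$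 with $\theta(\varnothing)=0$ and $\theta(A)=-x\log\mathbb{P}(\bigvee_{t\in A}X_t\le x)$ for non-empty finite $A\subset T$ (independent of $x>0$). *)

(* Defs.v *)
From HB Require Import structures.
From mathcomp Require Import all_boot all_order all_algebra finmap.
From mathcomp Require Import all_classical all_reals all_analysis.
Import Order.TTheory GRing.Theory Num.Theory.
Import numFieldNormedType.Exports.

Set Implicit Arguments.
Unset Strict Implicit.
Unset Printing Implicit Defensive.

Local Open Scope classical_set_scope.
Local Open Scope ring_scope.

Section processes.
Context {R : realType} {T : choiceType}.

(* Equality in law of two processes, possibly on different probability spaces:
   all finite-dimensional distributions, as laws on R^m, coincide. *)
Definition same_fdd d (U : measurableType d) (P : probability U R)
    d' (U' : measurableType d') (P' : probability U' R)
    (X : T -> U -> R) (X' : T -> U' -> R) : Prop :=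
  forall (m : nat) (t : 'I_m -> T) (B : set (m.-tuple R)), measurable B ->
    P [set w | B [tuple X (t i) w | i < m]] =
    P' [set w | B [tuple X' (t i) w | i < m]].

Definition sigma_process (U : Type) (X : T -> U -> R) : set (set U) :=
  <<s [set E | exists t, exists2 B : set R, measurable B & E = X t @^-1` B] >>.

(* For a finite family of sigma-algebras, each containing the whole space, the
   product rule over the full index set implies it over all subfamilies. *)
Definition independent_processes d (U : measurableType d) (P : probability U R)
    (n : nat) (Y : 'I_n -> T -> U -> R) : Prop :=
  forall E : 'I_n -> set U, (forall i, sigma_process (Y i) (E i)) ->
    P (\bigcap_i E i) = (\prod_(i < n) P (E i))%E.

(* The number n >= 1 of copies is written n.+1; the iterated maximum starts
   from one of its own terms, so it is the true maximum of the n.+1 values. *)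
Definition simple_max_stable d (U : measurableType d) (P : probability U R)
    (X : T -> {RV P >-> R}) : Prop :=
  (forall (t : T) (x : R), 0 < x ->
     P [set w | X t w <= x] = (expR (- (1 / x)))%:E) /\
  (forall (n : nat) (d' : measure_display) (U' : measurableType d')
      (P' : probability U' R) (Y : 'I_n.+1 -> T -> {RV P' >-> R}),
     (forall i, same_fdd P' P (Y i) X) ->
     independent_processes P' (fun i t => Y i t : U' -> R) ->
     same_fdd P' P
       (fun t w => \big[Num.max/Y ord0 t w]_(i < n.+1) Y i t w)
       (fun t w => n.+1%:R * X t w)).

(* [lne] is the extended logarithm ([lne 0 = -oo]), so that the equation below
   forces the probability to be positive; [ln 0 = 0] would not. *)
Definition extremal_coefficient_function
    d (U : measurableType d) (P : probability U R)
    (X : T -> {RV P >-> R}) (theta : {fset T} -> R) : Prop :=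
  [/\ forall A : {fset T}, 0 <= theta A,
      theta fset0 = 0 &
      forall A : {fset T}, A != fset0 -> forall x : R, 0 < x ->
        (theta A)%:E =
        (- (x%:E * lne (P [set w |
              \big[Order.max/-oo]_(t <- A) (X t w)%:E <= x%:E])))%E].

End processes.

(* The power set of T as {0,1}^T with the product topology, a subset Q being
   given by its indicator function. *)
Definition powerset_space (T : choiceType) := {ptws T -> bool}.

HB.instance Definition _ (T : choiceType) := Pointed.on (powerset_space T).
HB.instance Definition _ (T : choiceType) := Nbhs.on (powerset_space T).
HB.instance Definition _ (T : choiceType) := Topological.on (powerset_space T).

Definition nonempty_subsets (T : choiceType) : set (powerset_space T) :=
  [set Q | [set t | Q t] !=set0].
Arguments nonempty_subsets T : clear implicits.

Definition hitting (T : choiceType) (A : {fset T}) : set (powerset_space T) :=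
  [set Q | [set` A] `&` [set t | Q t] !=set0].

Definition borel (X : ptopologicalType) := g_sigma_algebraType (@open X).

(* Radon measures on a Borel subspace D of X.  The Borel (resp. compact) sets of
   the subspace D are the Borel (resp. compact) sets of X contained in D, and a
   measure on D is represented by a measure on X of which only the values on
   Borel subsets of D are considered.  This covers an empty D, which as a type
   could not carry a [measurableType] structure (these are pointed). *)
Definition radon_on (R : realType) (X : ptopologicalType) (D : set X)
    (mu : {measure set (borel X) -> \bar R}) : Prop :=
  (forall K : set X, compact K -> K `<=` D -> (mu K < +oo)%E) /\
  (forall B : set (borel X), measurable B -> B `<=` D ->
     mu B = ereal_sup [set mu K | K in [set K : set X | compact K /\ K `<=` B]]).

(* Main.v *)
(** Put [Z_n = {t : X_t > n}]. The extremal coefficient equation gives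
    [n * P(Z_n meets A) = n * (1 - exp (- theta A / n)) --> theta A], so [mu]
    has to be a vague limit of the measures [n * law(Z_n)]. Restricting these to
    the compact set [hitting A] makes them bounded on cylinders, hence convergent
    along an ultrafilter on [nat] to a finitely additive function, which extends
    to a finite Radon measure [mu_A] on the compact space [{0,1}^T]. The [mu_A]
    increase with [A], and [mu] is their supremum. Of the process, only the
    Frechet margins and the equation for [theta] matter.

    Uniqueness: the sets missing [A] form a pi-system, so [theta] determines a
    measure on cylinders, and compact sets are squeezed between cylinders. *)
Require Import Defs.
From HB Require Import structures.
From mathcomp Require Import all_boot all_order all_algebra finmap.
From mathcomp Require Import ring lra.
From mathcomp Require Import all_classical all_reals all_analysis.
Import Order.TTheory GRing.Theory Num.Theory.
Import numFieldNormedType.Exports.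

Set Implicit Arguments.
Unset Strict Implicit.
Unset Printing Implicit Defensive.

Local Open Scope classical_set_scope.
Local Open Scope ring_scope.

(** * Separating a compact set from the complement of an open set *)

Section clopen_base.
Context {X : ptopologicalType}.
Variable CC : set (set X).
Hypothesis CC0 : CC set0.
Hypothesis CCU : setU_closed CC.
Hypothesis CCopen : CC `<=` open.
Hypothesis CCbase : forall (x : X) V, open V -> V x ->
  exists C, [/\ CC C, C x & C `<=` V].

(** A finite subcover of [K] by members of [CC] inside [V] has its union in [CC]; [CC0] serves the
    empty subcover. *)
Lemma compact_open_separation (K V : set X) : compact K -> open V -> K `<=` V ->
  exists C, [/\ CC C, K `<=` C & C `<=` V].
Proof.
rewrite compact_cover => cK oV KV.
have [||D' D'D KD'] := cK (set X) [set C | CC C /\ C `<=` V] id.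
- by move=> C [/CCopen].
- by move=> x /KV /(CCbase oV)[C [CCC Cx CV]]; exists C.
have {}D'D C : C \in D' -> CC C /\ C `<=` V by move=> /D'D /set_mem.
exists (cover [set` D'] id); split => //; last first.
  by move=> x [C /= /D'D[_ CV] /CV].
rewrite /cover bigcup_fset big_seq.
by elim/big_ind : _ => // C /D'D[].
Qed.

End clopen_base.

(** * From a finitely additive content on clopen sets to a Radon measure *)

Section radon_extension.
Context {R : realType} {X : ptopologicalType}.
Variables (CC : set (set X)) (m : set X -> \bar R).
Local Open Scope ereal_scope.

(** The value that inner regularity forces on an open [V]: under the hypotheses below, compact
    subsets of [V] can be enlarged to members of [CC] inside [V], which are themselves compact. *)
Definition inner_content (V : set X) : \bar R :=
  ereal_sup [set m C | C in [set C | CC C /\ C `<=` V]].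

(* Approximating from outside by open sets, not by countable unions of sets of
   [CC], makes every Borel set measurable: for uncountable [T] the cylinders of
   [{0,1}^T] generate a strictly smaller sigma-algebra. *)
Definition outer_content (E : set X) : \bar R :=
  ereal_inf [set inner_content V | V in [set V | open V /\ E `<=` V]].

Hypothesis cptX : compact [set: X].
Hypothesis CC0 : CC set0.
Hypothesis CCU : setU_closed CC.
Hypothesis CCC : setC_closed CC.
Hypothesis CCopen : CC `<=` open.
Hypothesis CCbase : forall (x : X) V, open V -> V x ->
  exists C, [/\ CC C, C x & C `<=` V].
Hypothesis m0 : m set0 = 0.
Hypothesis m_ge0 : forall C, CC C -> 0 <= m C.
Hypothesis mU : forall C D, CC C -> CC D -> C `&` D = set0 ->
  m (C `|` D) = m C + m D.
Hypothesis mT : m setT < +oo.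

Let CCI : setI_closed CC.
Proof.
by move=> A B CA CB; rewrite -(setCK (A `&` B)) setCI; apply/CCC/CCU; exact: CCC.
Qed.

Let CCD A B : CC A -> CC B -> CC (A `\` B).
Proof. by move=> CA CB; rewrite setDE; apply/CCI => //; exact: CCC. Qed.

Let le_m C D : CC C -> CC D -> C `<=` D -> m C <= m D.
Proof.
move=> CCC' CCD' CD; rewrite -(setDUK CD) mU ?setDIK//; last exact: CCD.
by rewrite leeDl//; apply/m_ge0/CCD.
Qed.

Lemma inner_content_ge0 V : 0 <= inner_content V.
Proof. by rewrite -m0; apply: ereal_sup_ubound; exists set0; [split|]. Qed.

Lemma le_inner_content : {homo inner_content : V W / V `<=` W >-> V <= W}.
Proof.
move=> V W VW; apply: ge_ereal_sup => _ [C [CC_C CV] <-].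
by apply: ereal_sup_ubound; exists C => //; split => //; exact: subset_trans VW.
Qed.

Lemma inner_content_clopen C : CC C -> inner_content C = m C.
Proof.
move=> CC_C; apply/eqP; rewrite eq_le; apply/andP; split.
  by apply: ge_ereal_sup => _ [D [CC_D DC] <-]; exact: le_m.
by apply: ereal_sup_ubound; exists C; [split|].
Qed.

(** If [C] lies in the union, [C \ W] is a compact part of [V], hence inside some [D] of [CC] with
    [D] inside [V]. Then [C] splits into a piece in [V] and a piece in [W]. *)
Lemma inner_contentU2 V W : open V -> open W ->
  inner_content (V `|` W) <= inner_content V + inner_content W.
Proof.
move=> oV oW; apply: ge_ereal_sup => _ [C [CC_C CVW] <-].
have cK : compact (C `\` W).
  apply: (subclosed_compact _ cptX) => //; rewrite setDE.
  apply: closedI; last exact: open_closedC.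
  by rewrite -(setCK C); apply: open_closedC; apply/CCopen/CCC.
have [|D [CC_D KD DV]] := compact_open_separation CC0 CCU CCopen CCbase cK oV.
  by move=> x [/CVW[]].
have -> : C = (C `&` D) `|` (C `\` D) by rewrite setUIDK.
rewrite mU; [|exact: CCI|exact: CCD|by rewrite setDE setIACA setICr setI0].
apply: leeD; apply: ereal_sup_ubound.
  by exists (C `&` D) => //; split; [exact: CCI|move=> x [_ /DV]].
exists (C `\` D) => //; split; first exact: CCD.
by move=> x [Cx nDx]; apply: contrapT => Wx; apply: nDx; exact: KD.
Qed.

(** A clopen subset of the union is compact, so finitely many [V n] cover it and the binary case
    applies. *)
Lemma inner_content_sigma_subadditive (V : (set X)^nat) :
  (forall n, open (V n)) ->
  inner_content (\bigcup_n V n) <= \sum_(n <oo) inner_content (V n).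
Proof.
move=> oV; apply: ge_ereal_sup => _ [C [CC_C CV] <-].
have : compact C.
  apply: (subclosed_compact _ cptX) => //.
  by rewrite -(setCK C); apply: open_closedC; apply/CCopen/CCC.
rewrite compact_cover => /(_ nat setT V (fun n _ => oV n) CV)[D' _ CD'].
have [n D'n] : exists n, forall i, i \in D' -> (i < n)%N.
  exists (\max_(i <- D') i.+1) => i iD'.
  exact: (@leq_bigmax_seq _ _ xpredT succn).
pose W := \big[setU/set0]_(i < n) V i.
have CW : C `<=` W.
  move=> x /CD'[i /= iD' Vix].
  by rewrite /W -bigcup_mkord; exists i => //=; exact: D'n.
apply: (@le_trans _ _ (inner_content W)).
  by apply: ereal_sup_ubound; exists C; [split|].
apply: (@le_trans _ _ (\sum_(i < n) inner_content (V i))).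
  rewrite /W; elim: n {D'n W CW} => [|n ih].
    by rewrite !big_ord0 inner_content_clopen// m0.
  rewrite !big_ord_recr/=; apply: (le_trans (inner_contentU2 _ _)) => //.
    by rewrite -bigcup_mkord; apply: bigcup_open => i _; exact: oV.
  exact: leeD2r.
rewrite -(big_mkord xpredT (fun i => inner_content (V i))).
by apply: nneseries_lim_ge => i _ _; exact: inner_content_ge0.
Qed.

Lemma outer_content_open V : open V -> outer_content V = inner_content V.
Proof.
move=> oV; apply/eqP; rewrite eq_le; apply/andP; split.
  by apply: ereal_inf_lbound; exists V; [split|].
by apply: le_ereal_inf_tmp => _ [W [oW VW] <-]; exact: le_inner_content.
Qed.

Lemma outer_content_clopen C : CC C -> outer_content C = m C.
Proof.
by move=> CC_C; rewrite outer_content_open ?inner_content_clopen//; exact: CCopen.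
Qed.

Let outer_content0 : outer_content set0 = 0.
Proof. by rewrite outer_content_clopen. Qed.

Let outer_content_ge0 E : 0 <= outer_content E.
Proof. by apply: le_ereal_inf_tmp => _ [V _ <-]; exact: inner_content_ge0. Qed.

Let le_outer_content : {homo outer_content : A B / A `<=` B >-> A <= B}.
Proof.
move=> A B AB; apply: le_ereal_inf_tmp => _ [V [oV BV] <-].
by apply: ereal_inf_lbound; exists V => //; split => //; exact: subset_trans BV.
Qed.

Let outer_content_fin E : outer_content E \is a fin_num.
Proof.
rewrite ge0_fin_numE//; apply: le_lt_trans mT.
rewrite -outer_content_clopen//; last by rewrite -setC0; exact: CCC.
exact: le_outer_content.
Qed.

Let outer_content_sigma_subadditive : sigma_subadditive outer_content.
Proof.
move=> F; apply/lee_addgt0Pr => e e0.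
have /choice[V HV] : forall n, exists V, [/\ open V, F n `<=` V &
    inner_content V <= outer_content (F n) + (e / (2 ^ n.+1)%:R)%:E].
  move=> n; have en0 : (0 < e / (2 ^ n.+1)%:R)%R.
    by rewrite divr_gt0// ltr0n expn_gt0.
  have [_ [V [oV FV] <-] /ltW] := lb_ereal_inf_adherent en0 (outer_content_fin (F n)).
  by exists V.
apply: le_trans (epsilon_trick _ _ (ltW e0)) => //.
apply: (@le_trans _ _ (\sum_(n <oo) inner_content (V n))).
  have oV n : open (V n) by have [] := HV n.
  apply: le_trans (inner_content_sigma_subadditive oV).
  apply: ereal_inf_lbound; exists (\bigcup_n V n) => //; split.
    by apply: bigcup_open => n _; exact: oV.
  by apply: subset_bigcup => n _; have [] := HV n.
apply: lee_nneseries => n _; first by move=> _; exact: inner_content_ge0.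
by have [] := HV n.
Qed.

Let outerM : {outer_measure set X -> \bar R} := HB.pack outer_content
  (isOuterMeasure.Build R X outer_content outer_content0 outer_content_ge0
    le_outer_content outer_content_sigma_subadditive).

(** Fill [W] with two disjoint clopen sets: [C] inside [W] and [V], then [D] inside the open set
    [W \ C], which contains [W \ V]. Their contents add up to at most that of [W]; take suprema over
    [D], then over [C]. *)
Let open_caratheodory V : open V -> outerM.-caratheodory V.
Proof.
move=> oV; apply: le_caratheodory_measurable => E.
apply: le_ereal_inf_tmp => _ [W [oW EW] <-].
apply: (@le_trans _ _ (inner_content (W `&` V) + outer_content (W `&` ~` V))).
  apply: leeD; last by apply: le_outer_content; exact: setSI.
  rewrite -outer_content_open; last exact: openI.
  by apply: le_outer_content; exact: setSI.
rewrite -leeBrDr//; apply: ge_ereal_sup => _ [C [CC_C CWV] <-].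
rewrite leeBrDr// addeC.
have oWC : open (W `\` C) by rewrite setDE; apply/openI => //; apply/CCopen/CCC.
apply: (@le_trans _ _ (inner_content (W `\` C) + m C)).
  apply: leeD => //; rewrite -outer_content_open//.
  by apply: le_outer_content => x [Wx nVx]; split => // /CWV[].
have mCfin : m C \is a fin_num.
  by rewrite -outer_content_clopen.
rewrite -leeBrDr//; apply: ge_ereal_sup => _ [D [CC_D DWC] <-].
rewrite leeBrDr// -mU//; last by rewrite -subset0 => x [/DWC[]].
apply: ereal_sup_ubound; exists (D `|` C) => //; split; first exact: CCU.
by rewrite subUset; split=> x; [move=> /DWC[]|move=> /CWV[]].
Qed.

(** The first clause allows extensions of different contents to be compared; the third is inner
    regularity up to [e]. *)
Lemma radon_extension : exists mu : {measure set (borel X) -> \bar R},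
  [/\ forall B, mu B = outer_content B,
    forall C, CC C -> mu C = m C &
    forall (B : set (borel X)) (e : R), measurable B -> (0 < e)%R ->
      exists K : set X, [/\ compact K, K `<=` B & mu B <= mu K + e%:E]].
Proof.
have sub_cara (B : set (borel X)) : measurable B -> outerM.-caratheodory B.
  apply: smallest_sub; last exact: open_caratheodory.
  split.
  - exact: caratheodory_measurable_set0.
  - by move=> A cA; rewrite setTD; exact: caratheodory_measurable_setC.
  - by move=> A cA; exact: caratheodory_measurable_bigcup.
have sadd : semi_sigma_additive (outer_content : set (borel X) -> \bar R).
  move=> F mF tF mUF.
  apply: (@caratheodory_measure_sigma_additive _ _ outerM) => //.
    by move=> n; exact: sub_cara.
  exact: (sub_cara (\bigcup_n F n)).
pose mu : {measure set (borel X) -> \bar R} :=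
  HB.pack (outer_content : set (borel X) -> \bar R)
    (isMeasure.Build _ (borel X) R outer_content outer_content0 outer_content_ge0 sadd).
exists mu; split => //; first exact: outer_content_clopen.
move=> B e mB e0.
(* Inner approximation of [B] is outer approximation of its complement; the total mass is finite, so
   complements can be subtracted. *)
have [_ [V [oV BV] <-] Ve] :=
  lb_ereal_inf_adherent e0 (outer_content_fin (~` B)).
have mV : measurable (V : set (borel X)) by exact: sub_sigma_algebra.
exists (~` V); split.
- apply: (subclosed_compact _ cptX) => //; exact: open_closedC.
- by rewrite -(setCK B); exact: subsetC.
have muT : mu setT < +oo by rewrite -ge0_fin_numE// outer_content_fin.
have muC S : measurable S -> mu (~` S) = mu setT - mu S.
  by move=> mS; rewrite -setTD measureD// setTI.
have muE S : mu S = (fine (mu S))%:E by rewrite fineK//; exact: outer_content_fin.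
have : mu V <= mu (~` B) + e%:E by rewrite /= outer_content_open// ltW.
have := muC _ mB; rewrite (muC _ mV : mu (~` V) = _).
rewrite (muE V) (muE B) (muE (~` B)) (muE setT) -!EFinD !lee_fin => -[].
by lra.
Qed.

End radon_extension.

(** * Suprema of upward directed families of measures *)

Section directed_sup.
Context d {S : measurableType d} {R : realType} {I : Type}.
Variable mu : I -> {measure set S -> \bar R}.
Hypothesis mu_directed : forall i j, exists k, forall B, measurable B ->
  (mu i B <= mu k B)%E /\ (mu j B <= mu k B)%E.
Local Open Scope ereal_scope.

(** Subadditivity passes to any supremum; directedness gives the reverse inequality, since one index
    dominates finitely many. The index [i0] excludes the empty family, whose supremum is [-oo]. *)
Lemma directed_sup_measure (i0 : I) :
  exists nu : {measure set S -> \bar R},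
    forall B, nu B = ereal_sup [set mu i B | i in [set: I]].
Proof.
pose nu B := ereal_sup [set mu i B | i in [set: I]].
have nu_ge i B : mu i B <= nu B by apply: ereal_sup_ubound; exists i.
have nu0 : nu set0 = 0.
  rewrite /nu -(ereal_sup1 0); congr ereal_sup; apply/seteqP; split.
    by move=> _ [i _ <-]; rewrite measure0.
  by move=> _ ->; exists i0.
have nu_pos B : 0 <= nu B by apply: le_trans (nu_ge i0 B).
(* Induction on [n], splitting off the last set: an index [i] for the first sets and an index [j]
   for the last one are replaced by a common upper bound [l]. *)
have nu_sum (F : (set S)^nat) n c : (forall k, measurable (F k)) ->
    (forall i, \sum_(0 <= k < n) mu i (F k) <= c) ->
    \sum_(0 <= k < n) nu (F k) <= c.
  move=> mF; elim: n c => [|n ih] c Fc; first by have := Fc i0; rewrite !big_nil.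
  have Sc i : \sum_(0 <= k < n) mu i (F k) + mu i (F n) <= c.
    by rewrite -(big_nat_recr _ _ (fun k => mu i (F k))).
  have S0 i : 0 <= \sum_(0 <= k < n) mu i (F k) by exact: sume_ge0.
  (* For finite [c] all terms are finite and may be moved across the inequality. *)
  have [->|cy] := eqVneq c +oo; first exact: leey.
  have fin_c x : 0 <= x -> x <= c -> x \is a fin_num.
    by move=> x0 xc; rewrite ge0_fin_numE// (le_lt_trans xc)// ltey.
  have nuc : nu (F n) <= c.
    apply: ge_ereal_sup => _ [i _ <-].
    by apply: le_trans (Sc i); rewrite leeDr.
  rewrite big_nat_recr//= -leeBrDr; last exact: fin_c.
  apply: ih => i.
  have Sic : \sum_(0 <= k < n) mu i (F k) <= c.
    by apply: le_trans (Sc i); rewrite leeDl.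
  rewrite leeBrDr; last exact: fin_c.
  rewrite addeC -leeBrDr; last exact: fin_c.
  apply: ge_ereal_sup => _ [j _ <-].
  rewrite leeBrDr; last exact: fin_c.
  have [l lij] := mu_directed i j.
  apply: le_trans (Sc l); rewrite addeC; apply: leeD; last by have [] := lij _ (mF n).
  by apply: lee_sum => k _; have [] := lij _ (mF k).
have nu_additive : semi_sigma_additive nu.
  move=> F mF tF mUF.
  have nnF n : 0 <= nu (F n) by [].
  rewrite (_ : nu _ = \sum_(k <oo) nu (F k)).
    by apply: is_cvg_nneseries.
  apply/eqP; rewrite eq_le; apply/andP; split.
    apply: ge_ereal_sup => _ [i _ <-].
    rewrite measure_bigcup//=.
    rewrite (eq_eseriesl (Q := xpredT)); last by move=> k; rewrite in_setT.
    by apply: lee_nneseries.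
  apply: lime_le; first exact: is_cvg_nneseries.
  apply: nearW => n; apply: nu_sum => // i.
  apply: le_trans (nu_ge i _).
  rewrite measure_bigcup//=.
  rewrite (eq_eseriesl (Q := xpredT)); last by move=> k; rewrite in_setT.
  exact: nneseries_lim_ge.
pose nuM : {measure set S -> \bar R} :=
  HB.pack nu (isMeasure.Build _ S R nu nu0 nu_pos nu_additive).
by exists nuM.
Qed.

End directed_sup.

(** * Topology of [{0,1}^T]: hitting sets and cylinders *)

Section hitting_sets.
Context {T : choiceType}.
Implicit Types (A : {fset T}) (C K : set (powerset_space T)).

Lemma hittingP A (Q : powerset_space T) :
  hitting A Q <-> exists2 t, t \in A & Q t.
Proof. by split=> [[t [tA Qt]]|[t tA Qt]]; exists t. Qed.

Lemma hitting0 : hitting fset0 = set0 :> set (powerset_space T).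
Proof. by rewrite -subset0 => Q /hittingP[t]; rewrite inE. Qed.

Lemma hitting1 (t : T) : hitting [fset t]%fset = [set Q | Q t].
Proof.
apply/seteqP; split=> Q.
  by move=> /hittingP[s]; rewrite inE => /eqP ->.
by move=> Qt; apply/hittingP; exists t => //; rewrite inE.
Qed.

Lemma hittingU A B : hitting (A `|` B)%fset = hitting A `|` hitting B.
Proof.
apply/seteqP; split=> Q.
  move=> /hittingP[t]; rewrite inE => /orP[tA|tB] Qt; [left|right];
    by apply/hittingP; exists t.
by move=> [] /hittingP[t tA Qt]; apply/hittingP; exists t => //; rewrite inE tA ?orbT.
Qed.

Lemma sub_hitting A : hitting A `<=` nonempty_subsets T.
Proof. by move=> Q /hittingP[t _ Qt]; exists t. Qed.

Lemma nonempty_hittingI A : nonempty_subsets T `&` hitting A = hitting A.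
Proof. by rewrite setIidr//; exact: sub_hitting. Qed.

Lemma nonempty_subsetsE :
  nonempty_subsets T = \bigcup_t hitting [fset t]%fset.
Proof.
apply/seteqP; split=> Q.
  by move=> [t Qt]; exists t => //; rewrite hitting1.
by move=> [t _ /sub_hitting].
Qed.

Let open_coord (t : T) (b : bool) : open [set Q : powerset_space T | Q t = b].
Proof.
have -> : [set Q : powerset_space T | Q t = b] =
  @proj T (fun=> bool) t @^-1` [set b] by [].
apply: (@open_comp _ _ (@proj T (fun=> bool) t : powerset_space T -> bool)).
  by move=> Q _; exact: proj_continuous.
exact: discrete_open.
Qed.

Lemma clopen_hitting A : clopen (hitting A).
Proof.
have -> : hitting A = \bigcup_(t in [set` A]) [set Q | Q t = true].
  apply/seteqP; split=> [Q /hittingP[t]|Q [t tA Qt]]; first by exists t.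
  by apply/hittingP; exists t.
rewrite bigcup_fset; elim/big_ind : _.
- exact: clopen0.
- by move=> ? ?; exact: clopenU.
- move=> t _; split; first exact: open_coord.
  rewrite -openC (_ : ~` _ = [set Q : powerset_space T | Q t = false]).
    exact: open_coord.
  by apply/seteqP; split=> Q /=; case: (Q t).
Qed.

Lemma open_nonempty_subsets : open (nonempty_subsets T).
Proof.
by rewrite nonempty_subsetsE; apply: bigcup_open => t _; exact: (clopen_hitting _).1.
Qed.

Lemma compact_powerset : compact [set: powerset_space T].
Proof.
have := @tychonoff T (fun=> bool) (fun=> setT) (fun=> bool_compact).
by congr compact; apply/seteqP; split.
Qed.

Lemma hausdorff_powerset : hausdorff_space (powerset_space T).
Proof.
by apply: (@hausdorff_product T (fun=> bool)) => t; exact: discrete_hausdorff.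
Qed.

Lemma closed_powerset_compact K : closed K -> compact K.
Proof. by move=> cK; exact: (subclosed_compact cK compact_powerset (@subsetT _ _)). Qed.

Lemma compact_powerset_closed K : compact K -> closed K.
Proof. exact: (compact_closed hausdorff_powerset). Qed.

(** The open sets [hitting {t}] cover the non-empty subsets; the index set of a finite subcover is
    the required [A]. This reduces questions about compact sets to the sets [hitting A]. *)
Lemma compact_sub_hitting K : compact K -> K `<=` nonempty_subsets T ->
  exists A, K `<=` hitting A.
Proof.
rewrite compact_cover nonempty_subsetsE => cK KD.
have [|A _ KA] := cK _ _ _ _ KD.
  by move=> t _; exact: (clopen_hitting _).1.
by exists A => Q /KA[t /= tA]; rewrite hitting1 => Qt; apply/hittingP; exists t.
Qed.

Definition missing_sets : set (set (powerset_space T)) :=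
  [set ~` hitting A | A in [set: {fset T}]].

(* Clopen sets depend on finitely many coordinates and hence lie in the
   sigma-algebra generated by [missing_sets]; requiring this instead of proving
   it is enough, since such sets already form a base. *)
Definition cylinders : set (set (powerset_space T)) :=
  [set C | clopen C /\ <<s missing_sets >> C].

Lemma missing_setsI : setI_closed missing_sets.
Proof.
move=> _ _ [A _ <-] [B _ <-]; exists (A `|` B)%fset => //.
by rewrite hittingU setCU.
Qed.

Lemma missing_setsT : missing_sets setT.
Proof. by exists fset0 => //; rewrite hitting0 setC0. Qed.

Lemma cylinders0 : cylinders set0.
Proof. by split; [exact: clopen0|exact: sigma_algebra0]. Qed.

Lemma cylindersC : setC_closed cylinders.
Proof.
move=> C [cC sC]; split; first exact: (@clopenC _ _ set0 cC).
by rewrite -setTD; exact: sigma_algebraCD.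
Qed.

Lemma cylindersU : setU_closed cylinders.
Proof.
move=> C D [cC sC] [cD sD]; split; first exact: clopenU.
exact: (@measurableU _ (g_sigma_algebraType missing_sets)).
Qed.

Lemma cylindersI : setI_closed cylinders.
Proof.
move=> C D [cC sC] [cD sD]; split; first exact: clopenI.
exact: (@measurableI _ (g_sigma_algebraType missing_sets)).
Qed.

Lemma cylinders_open : cylinders `<=` open.
Proof. by move=> C [[]]. Qed.

Lemma cylinders_hitting A : cylinders (hitting A).
Proof.
rewrite -(setCK (hitting A)); apply: cylindersC; split.
  exact: (@clopenC _ _ set0 (clopen_hitting A)).
by apply: sub_sigma_algebra; exists A.
Qed.

(** Equivalently, the filter generated by the cylinders around [Q] converges to [Q]. In the product
    topology this is tested at each coordinate [t], where [hitting {t}] or its complement fixes the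
    value. *)
Lemma cylinders_base (Q : powerset_space T) (V : set (powerset_space T)) :
  open V -> V Q -> exists C, [/\ cylinders C, C Q & C `<=` V].
Proof.
move=> oV VQ.
pose F : set_system (powerset_space T) :=
  filter_from [set C | cylinders C /\ C Q] id.
have FF : Filter F.
  apply: filter_from_filter.
    exists setT; split => //; rewrite -setC0; exact/cylindersC/cylinders0.
  move=> C D [cC CQ] [cD DQ]; exists (C `&` D) => //.
  by split => //; exact: cylindersI.
suff : F --> Q.
  move=> /(_ V (open_nbhs_nbhs (conj oV VQ)))[C [cC CQ] CV].
  by exists C.
apply/cvg_sup => t A [_ [[W _ <-] /= WQ] WA].
apply: filterS WA _.
case Qt : (Q t) in WQ.
  exists (hitting [fset t]%fset).
    by split; [exact: cylinders_hitting|rewrite hitting1 /= Qt].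
  by move=> S; rewrite hitting1 /= => ->.
exists (~` hitting [fset t]%fset).
  split; first exact/cylindersC/cylinders_hitting.
  by rewrite hitting1 /= Qt.
by move=> S; rewrite hitting1 /=; case: (S t).
Qed.

Lemma measurable_cylinder (C : set (borel (powerset_space T))) :
  cylinders C -> measurable C.
Proof. by move=> [[oC _] _]; exact: sub_sigma_algebra. Qed.

Lemma measurable_hitting A : measurable (hitting A : set (borel (powerset_space T))).
Proof. exact: (measurable_cylinder (cylinders_hitting A)). Qed.

Lemma measurable_nonempty_subsets :
  measurable (nonempty_subsets T : set (borel (powerset_space T))).
Proof. by apply: sub_sigma_algebra; exact: open_nonempty_subsets. Qed.

Lemma measurable_compact K :
  compact K -> measurable (K : set (borel (powerset_space T))).
Proof.
move=> /compact_powerset_closed cK; rewrite -(setCK K).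
by apply: measurableC; apply: sub_sigma_algebra; exact: closed_openC.
Qed.

End hitting_sets.

(** * Uniqueness of the Radon measure *)

Section radon_uniqueness.
Context {R : realType} {T : choiceType}.
Implicit Types mu nu : {measure set (borel (powerset_space T)) -> \bar R}.
Local Open Scope ereal_scope.

(** By compactness [C] lies in some [hitting A]. Restricted to it, both measures are finite and
    agree on the pi-system of missing sets, because [hitting A \ hitting B = hitting (A U B) \
    hitting B]. *)
Lemma eq_hitting_cylinder mu nu :
  (forall A, mu (hitting A) < +oo) ->
  (forall A, mu (hitting A) = nu (hitting A)) ->
  forall C, cylinders C -> C `<=` nonempty_subsets T -> mu C = nu C.
Proof.
move=> fin_mu munu C cC CD.
have [A CA] := compact_sub_hitting (closed_powerset_compact cC.1.2) CD.
have mA := measurable_hitting A.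
have fin_nu B : nu (hitting B) < +oo by rewrite -munu.
have hittingD nu' B : (forall A, nu' (hitting A) < +oo) ->
    nu' (hitting A `\` hitting B) =
    nu' (hitting (A `|` B)%fset) - nu' (hitting B).
  move=> fin_nu'.
  have -> : hitting A `\` hitting B = hitting (A `|` B)%fset `\` hitting B.
    by rewrite hittingU setDUl setDv setU0.
  rewrite measureD ?fin_nu'//; try exact: measurable_hitting.
  by rewrite setIidr// hittingU; exact: subsetUr.
pose restr mu' : {measure set (borel (powerset_space T)) -> \bar R} := mrestr mu' mA.
suff : restr mu C = restr nu C by rewrite /= /mrestr (setIidl CA).
(* The constant sequence [setT] exhausts the space: it is the set missing [fset0], and its
   restricted mass is finite. *)
apply: (g_sigma_algebra_measure_unique (T := borel (powerset_space T))
  missing_sets _ (fun=> setT)); rewrite /= /mrestr.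
- by move=> _ [B _ <-]; apply: measurableC; exact: measurable_hitting.
- by move=> _; exact: missing_setsT.
- by apply/seteqP; split=> // Q _; exists 0%N.
- exact: missing_setsI.
- by move=> _ [B _ <-]; rewrite setIC -setDE !hittingD// !munu.
- by move=> _; rewrite setTI fin_mu.
- exact: cC.2.
Qed.

(** One inequality suffices by symmetry, and inner regularity of [mu] reduces [B] to a compact [K].
    A cylinder [C] around [K] avoiding a compact [K'] that nearly exhausts [hitting A \ K] for [nu]
    gives [mu K <= mu C = nu C <= nu K + e]. *)
Lemma radon_le mu nu :
  radon_on (nonempty_subsets T) mu -> radon_on (nonempty_subsets T) nu ->
  (forall A, mu (hitting A) = nu (hitting A)) ->
  forall B : set (borel (powerset_space T)), measurable B ->
    B `<=` nonempty_subsets T -> mu B <= nu B.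
Proof.
move=> [fin_mu reg_mu] [fin_nu reg_nu] munu B mB BD.
have cH A : compact (hitting A : set (powerset_space T)).
  by apply: closed_powerset_compact; exact: (clopen_hitting A).2.
have fmu A : mu (hitting A) < +oo by apply: fin_mu => //; exact: sub_hitting.
have fnu A : nu (hitting A) < +oo by rewrite -munu.
rewrite reg_mu//; apply: ge_ereal_sup => _ [K [cK KB] <-].
have mK := measurable_compact cK.
apply: (@le_trans _ _ (nu K)); last by apply: le_measure => //; rewrite inE.
have [A KA] := compact_sub_hitting cK (subset_trans KB BD).
have mA := measurable_hitting A.
apply/lee_addgt0Pr => e e0.
have mAK : measurable (hitting A `\` K : set (borel (powerset_space T))).
  exact: measurableD.
have AKD : hitting A `\` K `<=` nonempty_subsets T.
  by move=> Q [/sub_hitting].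
have nu_fin (E : set (borel (powerset_space T))) :
    measurable E -> E `<=` hitting A -> nu E \is a fin_num.
  move=> mE EA; rewrite ge0_fin_numE//; apply: le_lt_trans (fnu A).
  by apply: le_measure; rewrite ?inE.
(* Inner regularity of [nu] on the difference provides [K']. *)
have : nu (hitting A `\` K) - e%:E < nu (hitting A `\` K).
  by rewrite lteBlDr// lteDl ?nu_fin// ?lte_fin// => Q [].
rewrite {2}reg_nu// => /ereal_sup_gt[_ [K' [cK' K'AK] <-]] lt_nuK'.
have mK' := measurable_compact cK'.
have [|Q KQ|C [cC KC CAK']] := compact_open_separation cylinders0 cylindersU
  cylinders_open cylinders_base cK _ (V := hitting A `&` ~` K').
- apply: openI; first exact: (clopen_hitting A).1.
  by apply: closed_openC; exact: compact_powerset_closed.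
- by split; [exact: KA|move=> /K'AK[]].
have mC := measurable_cylinder cC.
apply: (@le_trans _ _ (mu C)); first by apply: le_measure; rewrite ?inE.
rewrite (eq_hitting_cylinder fmu munu cC); last by move=> Q /CAK'[/sub_hitting].
apply: (@le_trans _ _ (nu (hitting A `\` K'))).
  by apply: le_measure; rewrite ?inE//; exact: measurableD.
have K'A : K' `<=` hitting A by move=> Q /K'AK[].
have nuD (E : set (borel (powerset_space T))) : measurable E ->
    E `<=` hitting A -> nu (hitting A `\` E) = nu (hitting A) - nu E.
  by move=> mE EA; rewrite measureD ?fnu// setIidr.
move: lt_nuK'; rewrite (nuD K)// (nuD K')//.
rewrite -(fineK (nu_fin _ mA _))// -(fineK (nu_fin _ mK KA)) -(fineK (nu_fin _ mK' K'A)).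
by rewrite -!EFinD lte_fin lee_fin; lra.
Qed.


End radon_uniqueness.

(** * Vague limits along an ultrafilter *)

(** Compactness supplies a cluster point, and for an ultrafilter a cluster point is a limit: each
    preimage or its complement belongs to [F]. *)
Lemma ultra_cvg (I : Type) (F : set_system I) (X : ptopologicalType)
    (u : I -> X) (K : set X) :
  UltraFilter F -> compact K -> F (u @^-1` K) -> cvg (u @ F).
Proof.
move=> FU cK FK.
have [l [_ Fl]] := cK (u @ F) _ FK.
apply/cvg_ex; exists l => N /= Nl.
have [//|FN] := in_ultra_setVsetC (u @^-1` N) FU.
by have [x []] := Fl (~` N) N FN Nl.
Qed.

Section vague_limit.
Context {R : realType} {T : choiceType}.
Variables (v : nat -> set (powerset_space T) -> R) (theta : {fset T} -> R).
Hypothesis v_ge0 : forall n C, cylinders C -> 0 <= v n C.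
Hypothesis vU : forall n C D, cylinders C -> cylinders D -> C `&` D = set0 ->
  v n (C `|` D) = v n C + v n D.
Hypothesis v_theta : forall A, v n (hitting A) @[n --> \oo] --> theta A.

Let v0 n : v n set0 = 0.
Proof.
have := vU n cylinders0 cylinders0 (set0I _).
by rewrite setU0 => /eqP; rewrite addrC -subr_eq subrr eq_sym => /eqP.
Qed.

Let le_v n C D : cylinders C -> cylinders D -> C `<=` D -> v n C <= v n D.
Proof.
move=> cC cD CD; have cDC : cylinders (D `\` C).
  by rewrite setDE; apply: cylindersI => //; exact: cylindersC.
by rewrite -(setDUK CD) vU ?setDIK// lerDl v_ge0.
Qed.

(** Convergence is assumed on hitting sets only. An ultrafilter provides limits on all cylinders at
    once, where for uncountable [T] no diagonal subsequence is at hand. *)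
Lemma vague_limit : exists mu : {measure set (borel (powerset_space T)) -> \bar R},
  radon_on (nonempty_subsets T) mu /\
  forall A, mu (hitting A) = (theta A)%:E.
Proof.
have [U [UU ooU]] := ultraFilterLemma eventually_filter.
have Uth A : v n (hitting A) @[n --> U] --> theta A.
  by move=> N /v_theta; exact: ooU.
have cvI A C : cylinders C -> cylinders (C `&` hitting A).
  by move=> cC; apply: cylindersI => //; exact: cylinders_hitting.
(* Intersecting with [hitting A] keeps the values eventually in [[0, theta A + 1]]; any bound above
   [theta A] would do. *)
have v_cvg A C : cylinders C -> cvg (v n (C `&` hitting A) @[n --> U]).
  move=> cC; apply: (@ultra_cvg _ _ _ _ `[0, theta A + 1]).
    exact: segment_compact.
  have : \forall n \near U, v n (hitting A) <= theta A + 1.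
    by apply: (cvgr_le _ (Uth A)); rewrite ltrDl.
  apply: filterS => n vn /=; rewrite in_itv /= v_ge0; last exact: cvI.
  apply: le_trans vn; apply: le_v; [exact: cvI|exact: cylinders_hitting|].
  exact: subIsetr.
pose m A C := (lim (v n (C `&` hitting A) @[n --> U]))%:E.
have m_ge0 A C : cylinders C -> (0 <= m A C)%E.
  move=> cC; rewrite lee_fin; apply: limr_ge; first exact: v_cvg.
  by apply: nearW => n; apply: v_ge0; exact: cvI.
have m0 A : m A set0 = 0%E.
  rewrite /m; congr _%:E; apply: cvg_lim => //; rewrite set0I.
  by under eq_fun do rewrite v0; exact: cvg_cst.
have mU A C D : cylinders C -> cylinders D -> C `&` D = set0 ->
    m A (C `|` D) = (m A C + m A D)%E.
  move=> cC cD CD0; rewrite /m -EFinD; congr _%:E.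
  rewrite -limD; [|exact: v_cvg|exact: v_cvg].
  congr (lim (_ @ U)); apply/funext => n; rewrite setIUl vU//; try exact: cvI.
  by rewrite setIACA CD0 set0I.
have le_m A B C D : cylinders C -> cylinders D ->
    C `&` hitting A `<=` D `&` hitting B -> (m A C <= m B D)%E.
  move=> cC cD CD; rewrite lee_fin; apply: ler_lim; [exact: v_cvg|exact: v_cvg|].
  by apply: nearW => n; apply: le_v => //; exact: cvI.
have m_hitting A : m A (hitting A) = (theta A)%:E.
  by rewrite /m; congr _%:E; apply: cvg_lim => //; rewrite setIid; exact: Uth.
have /choice[mu mu_spec] A := radon_extension compact_powerset cylinders0
  cylindersU cylindersC cylinders_open cylinders_base (m0 A) (m_ge0 A) (mU A)
  (ltry _).
(* Monotonicity of [m] in the truncation set passes through the supremum and the infimum that define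
   [outer_content]. *)
have le_mu A B (E : set (borel (powerset_space T))) :
    {subset A <= B} -> (mu A E <= mu B E)%E.
  move=> AB; have [-> _ _] := mu_spec A; have [-> _ _] := mu_spec B.
  apply: le_ereal_inf_tmp => _ [V [oV EV] <-].
  apply: (@le_trans _ _ (inner_content cylinders (m A) V)).
    by apply: ereal_inf_lbound; exists V.
  apply: ge_ereal_sup => _ [C [cC CV] <-].
  apply: (@le_trans _ _ (m B C)).
    apply: le_m => // Q [CQ /hittingP[t tA Qt]]; split => //.
    by apply/hittingP; exists t => //; exact: AB.
  by apply: ereal_sup_ubound; exists C.
have [|nu nuE] := directed_sup_measure (mu := mu) _ fset0.
  move=> A B; exists (A `|` B)%fset => E _.
  by split; apply: le_mu => t tA; rewrite inE tA ?orbT.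
have mu_hitting A B : (mu A (hitting B) <= (theta B)%:E)%E.
  have [_ muE _] := mu_spec A; rewrite (muE _ (cylinders_hitting B)) -m_hitting.
  apply: le_m; try exact: cylinders_hitting.
  by rewrite setIid; exact: subIsetl.
exists nu; split; last first.
  move=> A; rewrite nuE; apply/eqP; rewrite eq_le; apply/andP; split.
    by apply: ge_ereal_sup => _ [B _ <-].
  apply: ereal_sup_ubound; exists A => //.
  by have [_ muE _] := mu_spec A; rewrite (muE _ (cylinders_hitting A)) m_hitting.
have le_nu K (B : set (borel (powerset_space T))) : compact K -> measurable B ->
    K `<=` B -> (nu K <= nu B)%E.
  by move=> cK mB KB; apply: le_measure; rewrite ?inE//; exact: measurable_compact.
split.
  move=> K cK /(compact_sub_hitting cK)[A KA].
  apply: le_lt_trans (ltry (theta A)).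
  apply: le_trans (le_nu _ _ cK (measurable_hitting A) KA) _.
  by rewrite nuE; apply: ge_ereal_sup => _ [B _ <-].
move=> B mB BD; apply/eqP; rewrite eq_le; apply/andP; split; last first.
  by apply: ge_ereal_sup => _ [K [cK KB] <-]; exact: le_nu.
(* Each [mu A] is inner regular and below [nu], so regularity passes to the supremum. *)
rewrite {1}nuE; apply: ge_ereal_sup => _ [A _ <-].
apply/lee_addgt0Pr => e e0.
have [_ _ /(_ B e mB e0)[K [cK KB /le_trans]]] := mu_spec A; apply.
rewrite leeD2r//; apply: (@le_trans _ _ (nu K)).
  by rewrite nuE; apply: ereal_sup_ubound; exists A.
by apply: ereal_sup_ubound; exists K.
Qed.

End vague_limit.

(** * Exceedance sets of the process and existence of the measure *)

(** With [x = n + 1], the bound [1 + y <= exp y] at [y = a / x] and [y = - a / x] yields [a / (1 + a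
    / x) <= x (1 - exp (- a / x)) <= a]. *)
Lemma cvg_scaled_oneBexpR (R : realType) (a : R) : 0 <= a ->
  n.+1%:R * (1 - expR (- (a / n.+1%:R))) @[n --> \oo] --> a.
Proof.
move=> a0.
pose f (n : nat) := a * (1 + a * harmonic n)^-1.
apply: (@squeeze_cvgr _ _ _ _ f (fun=> a)).
- apply: nearW => n; rewrite /f /harmonic /=.
  have : 0 < n.+1%:R :> R by rewrite ltr0n.
  move: (n.+1%:R) => x x0.
  have y0 : 0 <= a / x by rewrite divr_ge0// ltW.
  have y1 : 0 < 1 + a / x by rewrite ltr_wpDr.
  apply/andP; split.
    have -> : a * (1 + a / x)^-1 = x * (1 - (1 + a / x)^-1).
      by field; rewrite !gt_eqF//; lra.
    rewrite ler_pM2l// lerD2l lerN2 expRN lef_pV2 ?posrE ?expR_gt0//.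
    exact: expR_ge1Dx.
  have -> : a = x * (a / x) by rewrite mulrCA divff ?mulr1// gt_eqF.
  rewrite [in leLHS]mulrCA divff ?gt_eqF// mulr1.
  by rewrite ler_pM2l//; have := expR_ge1Dx (- (a / x)); lra.
- have : f n @[n --> \oo] --> a * (1 + a * 0)^-1.
    apply: cvgM; first exact: cvg_cst.
    apply: cvgV; first by rewrite mulr0 addr0 oner_neq0.
    apply: cvgD; first exact: cvg_cst.
    by apply: cvgM; [exact: cvg_cst|exact: cvg_harmonic].
  by rewrite mulr0 addr0 invr1 mulr1.
- exact: cvg_cst.
Qed.

Section exceedances.
Context {R : realType} {T : choiceType} {d : measure_display}
  {U : measurableType d} {P : probability U R}.
Variables (X : T -> {RV P >-> R}) (theta : {fset T} -> R).
Hypothesis htheta : extremal_coefficient_function X theta.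

(** The inequality is strict so that missing [A] is the event [max X_t <= x] over [A] that defines
    [theta]. *)
Definition exceedance (x : R) (w : U) : powerset_space T := fun t => x < X t w.

Lemma exceedance_missing x (A : {fset T}) :
  exceedance x @^-1` (~` hitting A) =
  \bigcap_(t in [set` A]) X t @^-1` `]-oo, x].
Proof.
apply/seteqP; split=> w /=.
  move=> nH t tA; rewrite /= in_itv/= leNgt; apply/negP => xX.
  by apply: nH; apply/hittingP; exists t.
move=> AX /hittingP[t tA]; rewrite /exceedance.
by have := AX t tA; rewrite /= in_itv/= leNgt => /negbTE ->.
Qed.

(** Restricted to the sigma-algebra of the missing sets: for uncountable [T] the preimage of an open
    set may be an uncountable union of events, which need not be measurable. *)
Lemma measurable_exceedance x C :
  <<s missing_sets >> C -> measurable (exceedance x @^-1` C).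
Proof.
move: C; apply: smallest_sub.
  split.
  - by rewrite /= preimage_set0.
  - by move=> C /= mC; rewrite setTD preimage_setC; exact: measurableC.
  - by move=> F /= mF; rewrite preimage_bigcup; exact: bigcup_measurable.
move=> _ [A _ <-] /=; rewrite exceedance_missing.
apply: fin_bigcap_measurable => //.
by move=> t _; rewrite -[X in measurable X]setTI; exact: measurable_funP.
Qed.

Lemma prob_exceedance_missing x (A : {fset T}) : 0 < x -> A != fset0 ->
  P (exceedance x @^-1` (~` hitting A)) = (expR (- (theta A / x)))%:E.
Proof.
move=> x0 A0; have [_ _ /(_ A A0 x x0)] := htheta.
have -> : [set w | (\big[Order.max/-oo]_(t <- A) (X t w)%:E <= x%:E)%E] =
    exceedance x @^-1` (~` hitting A).
  rewrite exceedance_missing; apply/seteqP; split=> w /=.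
    move=> AX t tA; rewrite /= in_itv/= -lee_fin; apply: le_trans AX.
    exact: (@le_bigmax_seq _ _ _ _ _ _ xpredT).
  move=> AX; rewrite big_seq; elim/big_ind : _; first exact: leNye.
    by move=> a b ax bx; rewrite ge_max ax.
  by move=> t tA; have := AX t tA; rewrite /= in_itv/= lee_fin.
set E := exceedance x @^-1` _.
have [r ->] : exists r, P E = r%:E.
  by exists (fine (P E)); rewrite fineK// fin_num_measure//;
    apply: measurable_exceedance; apply: sub_sigma_algebra; exists A.
(* If [r <= 0], the logarithm is [-oo] and the right side [+oo], which a real [theta A] excludes. *)
rewrite /=; case: ifPn => [_|].
  by rewrite gt0_muleNy ?lte_fin.
rewrite -ltNge => r0; rewrite -EFinM -EFinN => -[->].
by rewrite mulNr opprK mulrAC divff ?gt_eqF// mul1r lnK.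
Qed.

Lemma ecf_radon : exists mu : {measure set (borel (powerset_space T)) -> \bar R},
  radon_on (nonempty_subsets T) mu /\
  forall A, mu (hitting A) = (theta A)%:E.
Proof.
have mZ n C : cylinders C -> measurable (exceedance n.+1%:R @^-1` C).
  by move=> [_]; exact: measurable_exceedance.
(* Level and weight are both [n + 1], which keeps the level positive. *)
apply: (@vague_limit _ _
  (fun n C => n.+1%:R * fine (P (exceedance n.+1%:R @^-1` C)))).
- by move=> n C _; rewrite mulr_ge0// fine_ge0.
- move=> n C D cC cD CD0; rewrite preimage_setU measureU//;
    [|exact: (mZ _ _ cC)|exact: (mZ _ _ cD)|by rewrite -preimage_setI CD0 preimage_set0].
  by rewrite fineD ?fin_num_measure ?mulrDr//; exact: mZ.
move=> A; have [theta_ge0 theta0 _] := htheta.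
(* The logarithmic formula covers non-empty [A] only. *)
have [->|A0] := eqVneq A fset0.
  rewrite hitting0 theta0; under eq_fun do rewrite preimage_set0 measure0 mulr0.
  exact: cvg_cst.
under eq_fun => n.
  rewrite -(setCK (hitting A)) preimage_setC probability_setC; last first.
    exact: (mZ n _ (cylindersC (cylinders_hitting A))).
  rewrite prob_exceedance_missing//= ?ltr0n//.
  over.
exact: cvg_scaled_oneBexpR.
Qed.

End exceedances.

(** * Spectral representation of the extremal coefficient function, and boundedness *)

Theorem corollary16 (R : realType) (T : choiceType)
    (d : measure_display) (U : measurableType d) (P : probability U R)
    (X : T -> {RV P >-> R}) (theta : {fset T} -> R)
    (hX : simple_max_stable X)
    (htheta : extremal_coefficient_function X theta) :
  exists mu : {measure set (borel (powerset_space T)) -> \bar R},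
    [/\ radon_on (nonempty_subsets T) mu,
        forall A : {fset T},
          (theta A)%:E = mu (nonempty_subsets T `&` hitting A) /\
          (theta A)%:E =
            (\int[mu]_(Q in nonempty_subsets T) (\1_(hitting A) Q)%:E)%E,
        forall nu : {measure set (borel (powerset_space T)) -> \bar R},
          radon_on (nonempty_subsets T) nu ->
          (forall A : {fset T},
            (theta A)%:E = nu (nonempty_subsets T `&` hitting A)) ->
          forall B : set (borel (powerset_space T)),
            measurable B -> B `<=` nonempty_subsets T -> nu B = mu B,
        forall t : T, theta [fset t]%fset = 1 &
        bounded_fun theta <-> (mu (nonempty_subsets T) < +oo)%E].
Proof.
have [mu [rmu muE]] := ecf_radon htheta.
exists mu; split => //.
- move=> A; rewrite integral_indic; [|exact: measurable_nonempty_subsets|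
    exact: measurable_hitting].
  by rewrite (setIC (hitting A)) nonempty_hittingI muE.
- move=> nu rnu nuE B mB BD.
  have munu A : mu (hitting A) = nu (hitting A).
    by rewrite muE nuE nonempty_hittingI.
  by apply/eqP; rewrite eq_le !radon_le.
- move=> t; have tn0 : [fset t]%fset != fset0 :> {fset T}.
    by apply/fset0Pn; exists t; rewrite inE.
  (* At level 1 the Frechet margin [exp (-1)] equals [exp (- theta {t})]. *)
  have := prob_exceedance_missing htheta ltr01 tn0.
  have -> : exceedance X 1 @^-1` (~` hitting [fset t]%fset) = [set w | X t w <= 1].
    apply/seteqP; rewrite hitting1 /exceedance; split=> w /=.
      by move=> /negP; rewrite -leNgt.
    by rewrite leNgt => /negP.
  by rewrite hX.1// !divr1 => -[] /expR_inj /oppr_inj.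
have [fin_mu reg_mu] := rmu.
split=> [[M [_ theta_le]]|mu_fin].
  (* [bounded_fun] gives a bound by every number greater than [M], hence [M + 1]. *)
  have thetaM A : theta A <= M + 1.
    by apply: le_trans (ler_norm _) _; apply: theta_le => //; rewrite ltrDl.
  apply: (@le_lt_trans _ _ (M + 1)%:E); last exact: ltry.
  (* By inner regularity the total mass is a supremum over compact sets, each inside some
     [hitting A] of mass [theta A]. *)
  rewrite reg_mu//; last exact: measurable_nonempty_subsets.
  apply: ge_ereal_sup => _ [K [cK KD] <-].
  have [A KA] := compact_sub_hitting cK KD.
  apply: (@le_trans _ _ (mu (hitting A))); last by rewrite muE lee_fin.
  by apply: le_measure => //; rewrite inE;
    [exact: measurable_compact|exact: measurable_hitting].
have [theta_ge0 _ _] := htheta.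
exists (fine (mu (nonempty_subsets T))); split; first exact: num_real.
move=> M muM A _; rewrite /= ger0_norm//; apply: le_trans (ltW muM).
rewrite -lee_fin fineK ?ge0_fin_numE// -muE.
by apply: le_measure; rewrite ?inE; [exact: measurable_hitting|
  exact: measurable_nonempty_subsets|exact: sub_hitting].
Qed.
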